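(* Let $n_A\ge 2$ and let $n_X,n_Y,n_B\ge 1$ be integers. The prepare-and-measure scenario $(n_X;n_Y,n_B)$ with a classical message of alphabet size $n_A$ exhibits an adaptive advantage of non-signaling assistance over its non-adaptive use, i.e. $\mathrm{NS}^{\mathrm{NA}}(n_X;n_Y,n_B)_{n_A}\subsetneq\mathrm{NS}^{\mathrm A}(n_X;n_Y,n_B)_{n_A}$, if and only if $$n_X\ge n_A+1\quad\text{and}\quad n_B\ge n_A+2.$$
   Context: For a positive integer $n$, $[n]:=\{0,1,\dots,n-1\}$. Behavior: a behavior of the prepare-and-measure (PM) scenario $(n_X;n_Y,n_B)$ is a family $\mathbf q=[q(b|xy)]$ of real numbers, $b\in[n_B]$, $x\in[n_X]$, $y\in[n_Y]$, with $q(b|xy)\ge 0$ and $\sum_b q(b|xy)=1$ for all $x,y$. Non-signaling (NS) box: for finite input and output sets, a bipartite NS box is a family of conditional probability distributions $p(\alpha\beta|\xi\eta)$ (Alice: input $\xi$, output $\alpha$; Bob: input $\eta$, output $\beta$) such that $\sum_\beta p(\alpha\beta|\xi\eta)$ does not depend on $\eta$ and $\sum_\alpha p(\alpha\beta|\xi\eta)$ does not depend on $\xi$. Non-adaptive NS-assisted set: $\mathrm{NS}^{\mathrm{NA}}(n_X;n_Y,n_B)_{n_A}$ is the set of behaviors of $(n_X;n_Y,n_B)$ of the form $q(b|xy)=\sum_{a=0}^{n_A-1}\sum_\beta p(a\beta|xy)\,p(b|a\beta)$, where $p(a\beta|xy)$ is a bipartite NS box (Alice: input $x\in[n_X]$,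 output $a\in[n_A]$; Bob: input $y\in[n_Y]$, output $\beta$ in some finite set of arbitrary size) and $p(\cdot|a\beta)$ is a conditional probability distribution on $[n_B]$. Adaptive NS-assisted set: $\mathrm{NS}^{\mathrm A}(n_X;n_Y,n_B)_{n_A}$ is the set of behaviors of $(n_X;n_Y,n_B)$ of the form $q(b|xy)=\sum_{a=0}^{n_A-1}p(ab|x,(y,z=a))$, where $p(ab|x,(y,z))$ is a bipartite NS box (Alice: input $x\in[n_X]$, output $a\in[n_A]$; Bob: input the pair $(y,z)\in[n_Y]\times[n_A]$, output $b\in[n_B]$). One always has $\mathrm{NS}^{\mathrm{NA}}(n_X;n_Y,n_B)_{n_A}\subseteq\mathrm{NS}^{\mathrm A}(n_X;n_Y,n_B)_{n_A}$. *)

(* Defs.v *)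
From HB Require Import structures.
From mathcomp Require Import all_boot all_order all_algebra.
From mathcomp Require Import boolp classical_sets reals.

Set Implicit Arguments.
Unset Strict Implicit.
Unset Printing Implicit Defensive.

Import Order.TTheory GRing.Theory Num.Theory.
Local Open Scope classical_set_scope.
Local Open Scope ring_scope.

(* The alphabet [n] = {0, ..., n-1} is 'I_n. Conditional probabilities are
   written with the conditioning variables first: [q x y b] is q(b|xy) and
   [p x y (a, b)] is p(ab|xy). *)

Definition is_distr (R : realType) (T : finType) (p : T -> R) : Prop :=
  (forall t, 0 <= p t) /\ \sum_t p t = 1.

Definition is_behavior (R : realType) (nX nY nB : nat)
    (q : 'I_nX -> 'I_nY -> 'I_nB -> R) : Prop :=
  forall x y, is_distr (q x y).

(* X, A are the input and output sets of Alice, and Y, B those of Bob. *)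
Definition is_ns_box (R : realType) (X Y A B : finType)
    (p : X -> Y -> A * B -> R) : Prop :=
  [/\ forall x y, is_distr (p x y),
      forall x y y' a, \sum_b p x y (a, b) = \sum_b p x y' (a, b)
    & forall x x' y b, \sum_a p x y (a, b) = \sum_a p x' y (a, b)].

Definition NS_NA (R : realType) (nX nY nB nA : nat) :
    set ('I_nX -> 'I_nY -> 'I_nB -> R) :=
  [set q | is_behavior q /\
    exists (S : finType) (p : 'I_nX -> 'I_nY -> 'I_nA * S -> R)
           (d : 'I_nA -> S -> 'I_nB -> R),
      [/\ is_ns_box p,
          forall a s, is_distr (d a s)
        & forall x y b,
            q x y b = \sum_(a < nA) \sum_s p x y (a, s) * d a s b]].

Definition NS_A (R : realType) (nX nY nB nA : nat) :
    set ('I_nX -> 'I_nY -> 'I_nB -> R) :=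
  [set q | is_behavior q /\
    exists p : 'I_nX -> 'I_nY * 'I_nA -> 'I_nA * 'I_nB -> R,
      is_ns_box p /\
      forall x y b, q x y b = \sum_(a < nA) p x (y, a) (a, b)].

Arguments NS_NA : clear implicits.
Arguments NS_A : clear implicits.

(* Main.v *)
(** Writing n for nA, a behavior with q(b|xy) <= m_y(b) and
    sum_b m_y(b) = n for some m is in NS_A, and conversely every q in NS_A is
    dominated by the m obtained by summing Bob's marginals over z.

    If nX <= n, Alice sends her input.  If nB <= n, a generalised PR box with
    decoding b = a + k (mod n) produces every behavior.  If nB = n + 1, the
    numbers 1 - m_y(e), truncated at 0 and normalised, are the distribution of
    an output e that Bob discards: for every x the laws of e and of
    b ~ q(.|xy) can be coupled so that b <> e, and the n remaining outputs are
    handled by the PR box.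

    If nX > n and nB > n + 1, let x produce 0 with probability 1/n and its own
    output x + 1 otherwise.  Here sum_b max_x q(b|x) = n, so q is in NS_A.  For
    a fixed y a non-adaptive strategy is a mixture of strategies in which two
    of n + 1 inputs share a message, whence
    sum_(x <= n) (2 q(x+1|x) + q(0|x)) <= 2 n, which q violates. *)

Require Import Defs.
From mathcomp Require Import all_boot all_order all_algebra.
From mathcomp Require Import ring lra.
From mathcomp Require Import boolp classical_sets reals.

Set Implicit Arguments.
Unset Strict Implicit.
Unset Printing Implicit Defensive.

Import Order.TTheory GRing.Theory Num.Theory.
Local Open Scope classical_set_scope.
Local Open Scope ring_scope.

(** * Finite sums and point masses *)

Lemma sum_delta (R : pzRingType) (T : finType) (c : T) (F : T -> R) :
  \sum_t (t == c)%:R * F t = F c.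
Proof.
rewrite (bigD1 c) //= eqxx mul1r big1 ?addr0 // => t /negbTE ->.
by rewrite mul0r.
Qed.

Lemma sum_delta1 (R : pzRingType) (T : finType) (c : T) :
  \sum_t (t == c)%:R = 1 :> R.
Proof.
by rewrite -[RHS](sum_delta c (fun=> 1)); apply: eq_bigr => t _; rewrite mulr1.
Qed.

(** Translation by [a] permutes the group; this is how a uniform [k] is pinned down by the PR
    condition [a + k = c]. *)
Lemma sum_delta_shift (R : pzRingType) (V : finZmodType) (a c : V) (F : V -> R) :
  \sum_k (a + k == c)%:R * F (a + k) = F c.
Proof.
by rewrite -[RHS](sum_delta c F) [RHS](reindex_inj (addrI a)).
Qed.

Lemma sum_pair (R : nmodType) (A B : finType) (F : A * B -> R) :
  \sum_t F t = \sum_a \sum_b F (a, b).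
Proof. by rewrite pair_bigA; apply: eq_bigr => -[]. Qed.

Lemma sum_const_ord (R : pzRingType) (n : nat) (c : R) :
  \sum_(i < n) c = c * n%:R.
Proof. by rewrite sumr_const card_ord mulr_natr. Qed.

Lemma is_distr_delta (R : realType) (T : finType) (c : T) :
  is_distr (fun t => (t == c)%:R : R).
Proof. by split=> [t|]; [exact: ler0n | exact: sum_delta1]. Qed.

Lemma is_distr_le1 (R : realType) (T : finType) (p : T -> R) (t : T) :
  is_distr p -> p t <= 1.
Proof.
by move=> [p0 <-]; rewrite (bigD1 t) //= lerDl sumr_ge0.
Qed.

(** * Couplings of two laws that avoid the diagonal *)

(* Greedy: move mass off the diagonal until the support of r or q shrinks or
   some c has r c + q c = M, when J is forced: all mass outside row c goes to
   column c. *)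
Lemma off_diag_transport (R : realFieldType) (T : finType) (r q : T -> R)
    (M : R) :
  (forall t, 0 <= r t) -> (forall t, 0 <= q t) ->
  \sum_t r t = M -> \sum_t q t = M -> (forall t, r t + q t <= M) ->
  exists J : T -> T -> R,
    [/\ forall e b, 0 <= J e b, forall e, \sum_b J e b = r e,
        forall b, \sum_e J e b = q b & forall b, J b b = 0].
Proof.
have [k] := ubnP (#|[pred t | r t != 0]| + #|[pred t | q t != 0]|).
elim: k r q M => // k IH r q M ltk r0 q0 rM qM rqM.
have tight (r' q' : T -> R) (M' : R) (c : T) :
  (forall t, 0 <= r' t) -> (forall t, 0 <= q' t) ->
  \sum_t r' t = M' -> \sum_t q' t = M' -> r' c + q' c = M' ->
  exists J : T -> T -> R,
    [/\ forall e b, 0 <= J e b, forall e, \sum_b J e b = r' e,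
        forall b, \sum_e J e b = q' b & forall b, J b b = 0].
  move=> r'0 q'0 r'M q'M tc.
  (* Tightness at [c] says that the mass of [q'] outside [c] is [r' c], and that of [r'] outside [c]
     is [q' c]; so row and column [c] have the right sums. *)
  exists (fun e b => if e == c then (if b == c then 0 else q' b)
                     else if b == c then r' e else 0).
  split=> [e b|e|b|b].
  - by case: ifP; case: ifP.
  - case: (eqVneq e c) => [->|_].
      rewrite (bigD1 c) //= eqxx add0r.
      rewrite (eq_bigr q'); last by move=> b /negbTE ->.
      by move: q'M; rewrite (bigD1 c) //=; lra.
    by rewrite (bigD1 c) //= eqxx big1 ?addr0 // => b /negbTE ->.
  - case: (eqVneq b c) => [->|/negbTE nbc].
      rewrite (bigD1 c) //= eqxx add0r.
      rewrite (eq_bigr r'); last by move=> e /negbTE ->.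
      by move: r'M; rewrite (bigD1 c) //=; lra.
    by rewrite (bigD1 c) //= eqxx big1 ?addr0 // => e /negbTE ->.
  - by case: eqP.
case: (pselect (exists e b, [/\ e != b, r e != 0 & q b != 0])); last first.
  move=> none; exists (fun _ _ => 0).
  suff [rz qz] : (forall t, r t = 0) /\ (forall t, q t = 0).
    by split=> // [e|b]; rewrite big1 // ?rz ?qz.
  have sum0 (f : T -> R) : (forall t, 0 <= f t) -> \sum_t f t = 0 ->
      forall t, f t = 0.
    move=> f0 /eqP; rewrite psumr_eq0 // => /allP f_0 t.
    by apply/eqP/f_0; rewrite mem_index_enum.
  (* If [r e] is nonzero, all of [q] sits at [e], so [q e = M] and the bound at [e] contradicts
     [r e > 0]. *)
  suff M0 : M = 0 by split; apply: sum0 => //; rewrite ?rM ?qM.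
  case: (pselect (exists e, r e != 0)) => [[e re]|nr]; last first.
    rewrite -rM big1 // => t _; apply/eqP/negPn/negP => rt; apply: nr.
    by exists t.
  have qz b : b != e -> q b = 0.
    move=> nbe; apply/eqP/negPn/negP => qb; apply: none.
    by exists e, b; rewrite eq_sym.
  have qe : q e = M by rewrite -qM (bigD1 e) //= big1 ?addr0.
  by have := rqM e; have := r0 e; move: re; rewrite qe; lra.
move=> [e [b [neb re qb]]].
(* Moving mass t from e to b lowers M by t and keeps the slack at e and b. *)
have step (t : R) (r' := fun c => r c - (c == e)%:R * t)
    (q' := fun c => q c - (c == b)%:R * t) :
  0 <= t ->
  (exists J : T -> T -> R,
    [/\ forall e b, 0 <= J e b, forall e, \sum_b J e b = r' e,
        forall b, \sum_e J e b = q' b & forall b, J b b = 0]) ->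
  exists J : T -> T -> R,
    [/\ forall e b, 0 <= J e b, forall e, \sum_b J e b = r e,
        forall b, \sum_e J e b = q b & forall b, J b b = 0].
  move=> t0 [J [J0 Jr Jq Jd]].
  exists (fun c d => J c d + (c == e)%:R * (d == b)%:R * t).
  split=> [c d|c|d|c].
  - by rewrite addr_ge0 ?mulr_ge0 ?ler0n.
  - rewrite big_split /= Jr -mulr_suml -mulr_sumr sum_delta1 /r'; ring.
  - rewrite big_split /= Jq -mulr_suml -mulr_suml sum_delta1 /q'; ring.
  - rewrite Jd; case: (eqVneq c e) => [->|_]; last by rewrite !mul0r addr0.
    by rewrite (negbTE neb) mulr0 mul0r addr0.
have r'ge0 (t : R) c : t <= r e -> 0 <= r c - (c == e)%:R * t.
  by case: eqP => [->|_]; have := r0 c; rewrite ?mul1r ?mul0r; lra.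
have q'ge0 (t : R) c : t <= q b -> 0 <= q c - (c == b)%:R * t.
  by case: eqP => [->|_]; have := q0 c; rewrite ?mul1r ?mul0r; lra.
have r'sum (t : R) : \sum_c (r c - (c == e)%:R * t) = M - t.
  by rewrite sumrB rM -mulr_suml sum_delta1 mul1r.
have q'sum (t : R) : \sum_c (q c - (c == b)%:R * t) = M - t.
  by rewrite sumrB qM -mulr_suml sum_delta1 mul1r.
have re0 : 0 < r e by rewrite lt_def re r0.
have qb0 : 0 < q b by rewrite lt_def qb q0.
pose t := Num.min (r e) (q b).
have t0 : 0 < t by rewrite lt_min re0.
have tr : t <= r e by rewrite ge_min lexx.
have tq : t <= q b by rewrite ge_min lexx orbT.
(* Moving [t] empties [e] in [r] or [b] in [q], so the supports shrink; the lowered bound can fail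
   only at a third point. *)
case: (pselect (forall c, c != e -> c != b -> t <= M - r c - q c)) => [slack|].
  apply: (step t) => //; first exact: ltW.
  apply: (IH _ _ (M - t)); [|by move=> c; apply: r'ge0|by move=> c; apply: q'ge0
    |exact: r'sum|exact: q'sum|].
    have sr : [pred c | r c - (c == e)%:R * t != 0] \subset [pred c | r c != 0].
      apply/fintype.subsetP => c; rewrite !inE.
      by case: (eqVneq c e) => [->|_]; rewrite ?re // mul0r subr0.
    have sq : [pred c | q c - (c == b)%:R * t != 0] \subset [pred c | q c != 0].
      apply/fintype.subsetP => c; rewrite !inE.
      by case: (eqVneq c b) => [->|_]; rewrite ?qb // mul0r subr0.
    apply: leq_trans (ltk : (_ <= k)%N).
    have [rq|qr] := lerP (r e) (q b).
      rewrite -addSn leq_add ?subset_leq_card //; apply: proper_card.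
      apply/properP; split=> //; exists e; rewrite !inE // eqxx mul1r.
      by rewrite /t (min_idPl rq) subrr eqxx.
    rewrite -addnS leq_add ?subset_leq_card //; apply: proper_card.
    apply/properP; split=> //; exists b; rewrite !inE // eqxx mul1r.
    by rewrite /t (min_idPr (ltW qr)) subrr eqxx.
  move=> c; have := rqM c; case: (eqVneq c e) => [->|nce].
    by rewrite (negbTE neb) mul1r mul0r; lra.
  case: (eqVneq c b) => [->|ncb]; first by rewrite mul1r mul0r; lra.
  by have := slack c nce ncb; rewrite !mul0r; lra.
move=> /existsNP [c0 /not_implyP [n0e /not_implyP [n0b /negP]]].
rewrite -ltNge => c0t.
pose P := [pred c | (c != e) && (c != b)].
have P0 : P c0 by rewrite /= n0e n0b.
(* Some third point has slack below [t]. Moving only the least such slack [u] makes [c] tight for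
   the total [M - u]. *)
case: (arg_minP (fun c => M - r c - q c) P0) => c /andP[nce ncb].
set u := M - r c - q c => umin.
have u0 : 0 <= u by have := rqM c; rewrite /u; lra.
have ut : u <= t by apply: le_trans (umin _ P0) (ltW c0t).
have ur := le_trans ut tr; have uq := le_trans ut tq.
apply: (step u) => //.
apply: (tight _ _ (M - u) c) => //; [by move=> d; exact: r'ge0
  |by move=> d; exact: q'ge0|].
by rewrite (negbTE nce) (negbTE ncb) !mul0r /u; lra.
Qed.

(** * Non-adaptive simulation by PR boxes and by sending the input *)

(* The box is a PR box over Z/(nA): Alice's a and Bob's k are uniform, and
   a + k is the code of the output b in the encoding f e. *)
Lemma NS_NA_of_coupling (R : realType) (nX nY nB nA : nat) (E : finType)
    (q : 'I_nX -> 'I_nY -> 'I_nB -> R)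
    (J : 'I_nX -> 'I_nY -> E -> 'I_nB -> R)
    (f : E -> 'I_nB -> 'I_nA.+1) (g : E -> 'I_nA.+1 -> 'I_nB) :
  is_behavior q ->
  (forall x y e b, 0 <= J x y e b) ->
  (forall x x' y e, \sum_b J x y e b = \sum_b J x' y e b) ->
  (forall x y b, \sum_e J x y e b = q x y b) ->
  (forall x y e b, J x y e b != 0 -> g e (f e b) = b) ->
  NS_NA R nX nY nB nA.+1 q.
Proof.
move=> qb J0 JE Jq Jfg; split=> //.
have n0 : nA.+1%:R != 0 :> R by rewrite pnatr_eq0.
pose p (x : 'I_nX) (y : 'I_nY) (t : 'I_nA.+1 * (E * 'I_nA.+1)) : R :=
  nA.+1%:R^-1 * \sum_b (t.1 + t.2.2 == f t.2.1 b)%:R * J x y t.2.1 b.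
have pA x y a : \sum_s p x y (a, s) = nA.+1%:R^-1.
  rewrite sum_pair /p /= -[RHS]mulr1.
  under eq_bigr do rewrite -mulr_sumr.
  rewrite -mulr_sumr; congr (_ * _).
  rewrite -[RHS](proj2 (qb x y)); under [RHS]eq_bigr do rewrite -Jq.
  rewrite [RHS]exchange_big; apply: eq_bigr => e _.
  rewrite exchange_big; apply: eq_bigr => b _.
  exact: (sum_delta_shift a (f e b) (fun=> J x y e b)).
(* Bob's marginal sees [x] only through the law of [e] under [J x y], which is the same for all
   [x]. *)
have pB x y s : \sum_a p x y (a, s) = nA.+1%:R^-1 * \sum_b J x y s.1 b.
  rewrite /p /= -mulr_sumr; congr (_ * _).
  rewrite exchange_big; apply: eq_bigr => b _ /=.
  rewrite -[RHS](sum_delta_shift s.2 (f s.1 b) (fun=> J x y s.1 b)).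
  by apply: eq_bigr => a _; rewrite addrC.
exists (E * 'I_nA.+1)%type, p, (fun a s b => (b == g s.1 (a + s.2))%:R).
split.
- split=> [x y|x y y' a|x x' y s].
  + split=> [t|].
      by rewrite mulr_ge0 ?invr_ge0 ?ler0n ?sumr_ge0 // => b _; rewrite mulr_ge0.
    rewrite sum_pair; under eq_bigr do rewrite pA.
    by rewrite sum_const_ord mulVf.
  + by rewrite !pA.
  + by rewrite !pB (JE x x').
- by move=> a s; exact: is_distr_delta.
- move=> x y b.
  transitivity (\sum_(a < nA.+1) nA.+1%:R^-1 * q x y b).
    by rewrite sum_const_ord mulrAC mulVf // mul1r.
  apply: eq_bigr => a _; rewrite sum_pair /p /=.
  under [RHS]eq_bigr do under eq_bigr do rewrite -mulrA.
  under [RHS]eq_bigr do rewrite -mulr_sumr.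
  rewrite -mulr_sumr; congr (_ * _); rewrite -Jq; apply: eq_bigr => e _.
  under eq_bigr do rewrite mulr_suml.
  rewrite exchange_big /= -(sum_delta b (J x y e)).
  apply: eq_bigr => b' _.
  under eq_bigr do rewrite -mulrA.
  (* The only surviving [k] decodes to [g e (f e b')], which is [b'] wherever [J] has mass. *)
  rewrite (sum_delta_shift a (f e b') (fun c => J x y e b' * (b == g e c)%:R)).
  have [->|nz] := eqVneq (J x y e b') 0; first by rewrite mul0r mulr0.
  by rewrite (Jfg _ _ _ _ nz) mulrC (eq_sym b).
Qed.

(** Nothing needs to be discarded: [E] is a point, the coupling is [q] itself, and each output is
    its own code. *)
Lemma NS_NA_outputs_le_message (R : realType) (nX nY nB nA : nat)
    (q : 'I_nX -> 'I_nY -> 'I_nB -> R) :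
  (0 < nB)%N -> (nB <= nA)%N -> is_behavior q -> NS_NA R nX nY nB nA q.
Proof.
case: nB q => // nB q _; case: nA => // nA lenB qb.
apply: (@NS_NA_of_coupling R nX nY nB.+1 nA unit q (fun x y _ => q x y)
  (fun _ => widen_ord lenB) (fun _ c => inord c)) => //.
- by move=> x y _ b; exact: (proj1 (qb x y)).
- by move=> x x' y _; rewrite (proj2 (qb x y)) (proj2 (qb x' y)).
- by move=> x y b; rewrite big_const card_unit /= addr0.
- by move=> x y _ b _; rewrite inord_val.
Qed.

(** Alice's output is her input and Bob's is [y], so the decoder can sample from [q]. The default of
    [inord] concerns only messages that are never sent. *)
Lemma NS_NA_inputs_le_message (R : realType) (nX nY nB nA : nat)
    (q : 'I_nX -> 'I_nY -> 'I_nB -> R) :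
  (0 < nX)%N -> (nX <= nA)%N -> is_behavior q -> NS_NA R nX nY nB nA q.
Proof.
case: nX q => // nX q _ lenX qb; split=> //.
exists 'I_nY, (fun x y t => (t.1 == widen_ord lenX x)%:R * (t.2 == y)%:R),
  (fun a y => q (inord a) y); split.
- split=> [x y|x y y' a|x x' y s].
  + split=> [t|]; first by rewrite mulr_ge0 ?ler0n.
    rewrite sum_pair /= (eq_bigr (fun a => (a == widen_ord lenX x)%:R)).
      exact: sum_delta1.
    by move=> a _; rewrite -mulr_sumr sum_delta1 mulr1.
  + by rewrite /= -!mulr_sumr !sum_delta1.
  + by rewrite /= -!mulr_suml !sum_delta1.
- by move=> a y; exact: qb.
- move=> x y b /=.
  under eq_bigr => a _ do (under eq_bigr do rewrite -mulrA; rewrite -mulr_sumr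
    (sum_delta y (fun s => q (inord a) s b))).
  by rewrite (sum_delta (widen_ord lenX x) (fun a => q (inord a) y b)) /= inord_val.
Qed.

(** * Domination criteria for both assisted sets *)

(** The event [a = z] is bounded by Bob's marginal for input [(y, z)], which does not depend on [x];
    each of the [nA] values of [z] contributes total mass 1. *)
Lemma NS_A_dominated (R : realType) (nX nY nB nA : nat)
    (q : 'I_nX -> 'I_nY -> 'I_nB -> R) :
  (0 < nX)%N -> NS_A R nX nY nB nA q ->
  exists m : 'I_nY -> 'I_nB -> R,
    (forall x y b, q x y b <= m y b) /\ (forall y, \sum_b m y b = nA%:R).
Proof.
case: nX q => // nX q _ [_ [p [[pd _ pB] qE]]].
exists (fun y b => \sum_(z < nA) \sum_a p ord0 (y, z) (a, b)); split.
  move=> x y b; rewrite qE; apply: ler_sum => z _.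
  rewrite (pB ord0 x) (bigD1 z) //= lerDl sumr_ge0 // => a _.
  exact: (proj1 (pd _ _)).
move=> y; rewrite exchange_big /=.
under eq_bigr => z _ do rewrite exchange_big /= -sum_pair (proj2 (pd _ _)).
by rewrite sumr_const card_ord.
Qed.

Lemma NS_A_of_dominated (R : realType) (nX nY nB nA : nat)
    (q : 'I_nX -> 'I_nY -> 'I_nB -> R) (m : 'I_nY -> 'I_nB -> R) :
  (1 < nA)%N -> is_behavior q -> (forall x y b, q x y b <= m y b) ->
  (forall y, \sum_b m y b = nA%:R) -> NS_A R nX nY nB nA q.
Proof.
move=> n1 qb qm mn; split=> //.
have n0 : nA%:R != 0 :> R by rewrite pnatr_eq0 -lt0n ltnW.
have n10 : 0 < nA%:R - 1 :> R by rewrite subr_gt0 ltr1n.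
have n10' : nA%:R - 1 != 0 :> R by rewrite gt_eqF.
(* Alice's output is uniform. The law for [a != z] is the normalised remainder [m - q], so that
   Bob's marginal becomes [m / nA], free of [x]. *)
pose p (x : 'I_nX) (t : 'I_nY * 'I_nA) (s : 'I_nA * 'I_nB) : R :=
  if s.1 == t.2 then q x t.1 s.2 / nA%:R
  else (m t.1 s.2 - q x t.1 s.2) / (nA%:R * (nA%:R - 1)).
have pA x t a : \sum_b p x t (a, b) = nA%:R^-1.
  rewrite /p /=; case: eqP => _; rewrite -mulr_suml ?sumrB (proj2 (qb _ _)).
    by rewrite mul1r.
  by rewrite mn invfM mulrCA divff // mulr1.
have pB x t b : \sum_a p x t (a, b) = m t.1 b / nA%:R.
  rewrite /p (bigD1 t.2) //= eqxx.
  rewrite (eq_bigr (fun=> (m t.1 b - q x t.1 b) / (nA%:R * (nA%:R - 1)))); last first.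
    by move=> a /negbTE ->.
  rewrite sumr_const cardC1 card_ord -(mulr_natr _ nA.-1) -subn1 natrB 1?ltnW //.
  by field; rewrite n0.
exists p; split; last first.
  move=> x y b; rewrite /p /=.
  under eq_bigr do rewrite eqxx.
  by rewrite sum_const_ord divfK.
split=> [x t|x t t' a|x x' t b]; last 2 first.
- by rewrite !pA.
- by rewrite !pB.
split=> [s|].
  rewrite /p; case: ifP => _; rewrite divr_ge0 ?ler0n //.
  - exact: (proj1 (qb _ _)).
  - by rewrite subr_ge0.
  - by rewrite mulr_ge0 ?ler0n // ltW.
rewrite sum_pair; under eq_bigr do rewrite pA.
by rewrite sum_const_ord mulVf.
Qed.

Lemma NS_NA_of_dominated (R : realType) (nX nY nA : nat)
    (q : 'I_nX -> 'I_nY -> 'I_nA.+1 -> R) (m : 'I_nY -> 'I_nA.+1 -> R) :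
  (0 < nA)%N -> is_behavior q -> (forall x y b, q x y b <= m y b) ->
  (forall y, \sum_b m y b = nA%:R) -> NS_NA R nX nY nA.+1 nA q.
Proof.
case: nA q m => // nA q m _ qb qm mn.
pose w y b : R := Num.max 0 (1 - m y b).
have w0 y b : 0 <= w y b by rewrite le_max lexx.
(* Over [nA + 1] outputs the numbers [1 - m y b] add up to 1, and truncation only raises them; hence
   normalising [w] does not increase it. *)
have wsum y : 1 <= \sum_b w y b.
  have <- : \sum_b (1 - m y b) = 1.
    by rewrite sumrB mn sumr_const card_ord -natrB // subSnn.
  by apply: ler_sum => b _; rewrite le_max lexx orbT.
pose r y b := w y b / \sum_c w y c.
have ws0 y : 0 < \sum_b w y b by apply: lt_le_trans (wsum y).
have r0 y b : 0 <= r y b by rewrite divr_ge0 // ltW.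
have rw y b : r y b <= w y b by rewrite ler_pdivrMr // ler_peMr.
have rsum y : \sum_b r y b = 1 by rewrite -mulr_suml divff // gt_eqF.
(* This is the bound required for a coupling off the diagonal: [q <= m], while [r] is at most
   [1 - m] or is 0. *)
have rq x y b : r y b + q x y b <= 1.
  rewrite -lerBrDr (le_trans (rw y b)) // /w ge_max.
  rewrite subr_ge0 (is_distr_le1 _ (qb x y)) /=.
  by rewrite lerD2l lerN2.
have /choice [J HJ] : forall t : 'I_nX * 'I_nY,
    exists J : 'I_nA.+2 -> 'I_nA.+2 -> R,
      [/\ forall e b, 0 <= J e b, forall e, \sum_b J e b = r t.2 e,
        forall b, \sum_e J e b = q t.1 t.2 b & forall b, J b b = 0].
  move=> [x y] /=; apply: (off_diag_transport (M := 1)) => //.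
  - exact: (proj1 (qb x y)).
  - exact: (proj2 (qb x y)).
(* [lift e] enumerates the outputs other than [e]; the default [ord0] is taken only at [b = e],
   where the coupling vanishes. *)
apply: (@NS_NA_of_coupling R nX nY nA.+2 nA 'I_nA.+2 q (fun x y => J (x, y))
  (fun e b => odflt ord0 (unlift e b)) (fun e c => lift e c)) => //.
- by move=> x y; case: (HJ (x, y)).
- by move=> x x' y e; case: (HJ (x, y)) (HJ (x', y)) => _ -> _ _ [_ -> _ _].
- by move=> x y; case: (HJ (x, y)).
- move=> x y e b; case: unliftP => [j ->//|->].
  by case: (HJ (x, y)) => _ _ _ ->; rewrite eqxx.
Qed.

(** * Inclusion, a Bell inequality and strict separation *)

(** Bob can run the decoder inside the box, with [z] in place of the received message. *)
Lemma NS_NA_sub_NS_A (R : realType) (nX nY nB nA : nat) :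
  NS_NA R nX nY nB nA `<=` NS_A R nX nY nB nA.
Proof.
move=> q [qb [S [p [d [[pd pA pB] dd qE]]]]]; split=> //.
pose p' (x : 'I_nX) (t : 'I_nY * 'I_nA) (u : 'I_nA * 'I_nB) : R :=
  \sum_s p x t.1 (u.1, s) * d t.2 s u.2.
have p'A x t a : \sum_b p' x t (a, b) = \sum_s p x t.1 (a, s).
  rewrite exchange_big; apply: eq_bigr => s _ /=.
  by rewrite -mulr_sumr (proj2 (dd _ _)) mulr1.
exists p'; split; last by [].
split=> [x t|x t t' a|x x' t b].
- split=> [u|].
    apply: sumr_ge0 => s _; apply: mulr_ge0; first exact: (proj1 (pd _ _)).
    exact: (proj1 (dd _ _)).
  rewrite sum_pair; under eq_bigr do rewrite p'A.
  by rewrite -sum_pair (proj2 (pd _ _)).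
- by rewrite !p'A (pA x t.1 t'.1).
- rewrite exchange_big [RHS]exchange_big; apply: eq_bigr => s _ /=.
  by rewrite -!mulr_suml (pB x x').
Qed.

(** Bob's [s] has a law independent of the input, so it suffices to bound the score for each fixed
    [s], letting every input pick its best message. *)
Lemma NS_NA_bell_inequality (R : realType) (nX nY nB nA : nat)
    (q : 'I_nX -> 'I_nY -> 'I_nB -> R) (i : 'I_nA.+1 -> 'I_nX)
    (b0 : 'I_nB) (o : 'I_nA.+1 -> 'I_nB) (y : 'I_nY) :
  (0 < nA)%N -> injective o -> (forall j, o j != b0) ->
  NS_NA R nX nY nB nA q ->
  \sum_j (2 * q (i j) y (o j) + q (i j) y b0) <= 2 * nA%:R.
Proof.
case: nA i o => // nA i o _ oi ob [_ [S [p [d [[pd _ pB] dd qE]]]]].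
pose W s j a : R := 2 * d a s (o j) + d a s b0.
pose P s := \sum_a p (i ord0) y (a, s).
have P0 s : 0 <= P s by apply: sumr_ge0 => a _; exact: (proj1 (pd _ _)).
pose best s j := [arg max_(a > ord0) W s j a]%O.
have bestP s j a : W s j a <= W s j (best s j).
  by rewrite /best; case: arg_maxP => // c _; apply.
have qW j : 2 * q (i j) y (o j) + q (i j) y b0
    = \sum_s \sum_a p (i j) y (a, s) * W s j a.
  rewrite !qE mulr_sumr -big_split exchange_big /=; apply: eq_bigr => a _.
  rewrite mulr_sumr -big_split; apply: eq_bigr => s _ /=.
  by rewrite /W; ring.
have d0 a s b : 0 <= d a s b by exact: (proj1 (dd a s)).
have W2 s j a : W s j a <= 2.
  have := proj2 (dd a s); rewrite (bigD1 (o j)) //= (bigD1 b0) 1?eq_sym ?ob //=.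
  have := @sumr_ge0 R _ (index_enum 'I_nB) (fun b => (b != o j) && (b != b0))
    (d a s) (fun b _ => d0 a s b).
  by have := d0 a s b0; have := d0 a s (o j); rewrite /W; lra.
have WW s j k a : j != k -> W s j a + W s k a <= 2.
  move=> njk.
  have := proj2 (dd a s); rewrite (bigD1 (o j)) //= (bigD1 b0) 1?eq_sym ?ob //=.
  rewrite (bigD1 (o k)) /=; last by rewrite ob (inj_eq oi) eq_sym njk.
  have := @sumr_ge0 R _ (index_enum 'I_nB)
    (fun b => (b != o j) && (b != b0) && (b != o k))
    (d a s) (fun b _ => d0 a s b).
  by rewrite /W; lra.
have best_sum s : \sum_j W s j (best s j) <= 2 * nA.+1%:R.
  (* By pigeonhole two inputs share their best message. Together they score at most 2, as [o j],
     [o k] and [b0] are distinct; each of the others scores at most 2. *)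
  have /injectivePn [j [k njk bjk]] : ~~ injectiveb (best s).
    by apply/negP => /injectiveP /leq_card; rewrite !card_ord ltnn.
  rewrite (bigD1 j) //= (bigD1 k) 1?eq_sym //= addrA.
  have -> : 2 * nA.+1%:R = 2 + \sum_(l < nA.+2 | (l != j) && (l != k)) 2 :> R.
    have := @sumr_const R 'I_nA.+2 predT 2.
    rewrite (bigD1 j) //= (bigD1 k) 1?eq_sym //= card_ord => E.
    move: E; rewrite -mulr_natr -addn1 natrD; lra.
  apply: lerD; last exact: ler_sum.
  by rewrite bjk WW.
under eq_bigr do rewrite qW.
rewrite exchange_big /=.
have -> : 2 * nA.+1%:R = \sum_s P s * (2 * nA.+1%:R).
  rewrite -mulr_suml /P exchange_big -sum_pair (proj2 (pd _ _)); lra.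
apply: ler_sum => s _.
apply: le_trans (ler_wpM2l (P0 s) (best_sum s)).
rewrite mulr_sumr; apply: ler_sum => j _.
(* Non-signaling lets the weight of [s] be computed at the input [i j]. *)
rewrite /P (pB _ (i j)) mulr_suml; apply: ler_sum => a _.
apply: ler_wpM2l => //; exact: (proj1 (pd _ _)).
Qed.

Lemma NS_A_not_sub_NS_NA (R : realType) (nX nY nB nA : nat) :
  (1 < nA)%N -> (0 < nY)%N -> (nA < nX)%N -> (nA.+1 < nB)%N ->
  ~ (NS_A R nX nY nB nA `<=` NS_NA R nX nY nB nA).
Proof.
case: nY => // nY n1 _ nAX; case: nB => // nB nAB sub.
have n0 : 0 < nA%:R :> R by rewrite ltr0n ltnW.
have nn0 : nA%:R != 0 :> R by rewrite gt_eqF.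
pose o (j : 'I_nA.+1) : 'I_nB.+1 := inord j.+1.
have oE j : o j = j.+1 :> nat.
  by rewrite inordK // ltnS (leq_trans (ltn_ord j)).
(* Inputs beyond [nA] imitate input [nA], so only [nA + 1] distinct laws occur. *)
pose h (x : 'I_nX) : 'I_nA.+1 := inord (minn x nA).
(* With this [u] the dominating weights sum to [u + (nA + 1) * (1 - u) = nA]. *)
pose u : R := nA%:R^-1.
have u0 : 0 < u by rewrite invr_gt0.
have u1 : u < 1 by rewrite invf_lt1 // ltr1n.
pose q (x : 'I_nX) (_ : 'I_nY.+1) b : R :=
  (b == ord0)%:R * u + (b == o (h x))%:R * (1 - u).
have qb : is_behavior q.
  move=> x y; split=> [b|].
    by rewrite addr_ge0 // mulr_ge0 ?ler0n // ?subr_ge0 ltW.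
  by rewrite big_split /= -!mulr_suml !sum_delta1; ring.
have qA : NS_A R nX nY.+1 nB.+1 nA q.
  apply: (@NS_A_of_dominated _ _ _ _ _ q
    (fun _ b => (b == ord0)%:R * u + \sum_j (b == o j)%:R * (1 - u))) => //.
    move=> x y b; rewrite lerD2l (bigD1 (h x)) //= lerDl sumr_ge0 // => j _.
    by rewrite mulr_ge0 ?ler0n // subr_ge0 ltW.
  move=> y; rewrite big_split /= -mulr_suml sum_delta1 exchange_big /=.
  under eq_bigr do rewrite -mulr_suml sum_delta1 mul1r.
  rewrite sum_const_ord -addn1 natrD /u.
  by field.
have oi : injective o.
  by move=> j k /(congr1 val) /=; rewrite !oE => -[] /val_inj.
have on0 j : o j != ord0 by rewrite -val_eqE /= oE.
have := @NS_NA_bell_inequality R nX nY.+1 nB.+1 nA q (widen_ord nAX) ord0 o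
  ord0 (ltnW n1) oi on0 (sub q qA).
apply/negP; rewrite -ltNge.
(* The score [(nA + 1) * (2 - u)] equals [2 * nA + 1 - u], which exceeds [2 * nA] because
   [u < 1]. *)
apply: (@lt_le_trans _ _ (\sum_(j < nA.+1) (2 * (1 - u) + u))).
  rewrite sum_const_ord -addn1 natrD.
  have un : u * nA%:R = 1 by rewrite mulVf.
  by nra.
apply: ler_sum => j _; rewrite /q.
have -> : h (widen_ord nAX j) = j.
  by rewrite /h /= (minn_idPl _) ?inord_val // -ltnS.
rewrite !eqxx (negbTE (on0 j)).
by case: eqP => _ /=; lra.
Qed.

Theorem mainTheorem4 (R : realType) (nX nY nB nA : nat)
    (hnA : (2 <= nA)%N) (hnX : (1 <= nX)%N) (hnY : (1 <= nY)%N)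
    (hnB : (1 <= nB)%N) :
  (NS_NA R nX nY nB nA `<` NS_A R nX nY nB nA) <->
  ((nA + 1 <= nX)%N /\ (nA + 2 <= nB)%N).
Proof.
rewrite addn1 addn2; split=> [[_ nsub]|[lX lB]]; last first.
  by split; [exact: NS_NA_sub_NS_A | exact: NS_A_not_sub_NS_NA].
(* If either bound fails, the reverse inclusion holds. Only the case [nB = nA + 1] uses the adaptive
   strategy of [q], through its dominating [m]. *)
split; rewrite ltnNge; apply/negP => le; apply: nsub => q qA.
  by apply: NS_NA_inputs_le_message => //; case: qA.
move: le; rewrite leq_eqVlt ltnS => /predU1P[EB|le]; last first.
  by apply: NS_NA_outputs_le_message => //; case: qA.
have [m [qm mn]] := NS_A_dominated hnX qA.
rewrite {hnB}EB in q qA m qm mn *.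
by apply: (NS_NA_of_dominated (ltnW hnA) _ qm mn); case: qA.
Qed.
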